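(* Let $(Z_n)_{n\in\mathbb N}$ be a stationary, ergodic Markov chain on a finite subset of $\mathbb R$ with invariant measure $\rho$. Assume that $\mathbb E(Z_i^2)=1$ for all $i\in\mathbb N$ and that for all odd numbers $k$ and all $i_1,\dots,i_k$ we have $\mathbb E(Z_{i_1}Z_{i_2}\cdots Z_{i_k})=0$. Then for all even $k$ there are constants $C>0$ and $\beta\in[0,1)$ such that for all $i_1\le i_2\le\dots\le i_k$, with $n_j:=i_{j+1}-i_j$, $$|\mathbb E(Z_{i_1}Z_{i_2}\cdots Z_{i_k})|\le C\beta^{n_1+n_3+\dots+n_{k-1}},$$ and for all $j_1\le\dots\le j_k$, with $d:=\min_{n,m\in\{1,\dots,k\}}|i_n-j_m|$, $$|\mathbb E(Z_{i_1}\cdots Z_{i_k}Z_{j_1}\cdots Z_{j_k})-\mathbb E(Z_{i_1}\cdots Z_{i_k})\,\mathbb E(Z_{j_1}\cdots Z_{j_k})|\le C\beta^{d}.$$ Moreover, for $d':=\min_{j=1,\dots,k-1}(i_{j+1}-i_j)$, $$|\mathbb E(Z_{i_1}^2Z_{i_2}^2\cdots Z_{i_k}^2)-1|\le C\beta^{d'}.$$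
   Context: The chain is time-homogeneous; ''stationary'' means that $Z_1$ has law $\rho$, and ''ergodic'' means irreducible and aperiodic. The constants $C,\beta$ may depend on $k$ and on the chain but not on the indices. Convention: $0^0=1$. *)

(* Defs.v *)
From HB Require Import structures.
From mathcomp Require Import all_boot all_order all_algebra finmap.
From mathcomp Require Import all_classical all_reals all_analysis.

Set Implicit Arguments.
Unset Strict Implicit.
Unset Printing Implicit Defensive.

Import Order.TTheory GRing.Theory Num.Theory.

Local Open Scope classical_set_scope.
Local Open Scope ring_scope.

Section FiniteKernel.
Context {R : realType} {S : finType}.
Implicit Types (p : S -> S -> R) (rho : S -> R).

Definition stochastic p : Prop :=
  (forall x y, 0 <= p x y) /\ (forall x, \sum_y p x y = 1).

Fixpoint nstep p (n : nat) (x y : S) : R :=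
  if n is m.+1 then \sum_z p x z * nstep p m z y else (x == y)%:R.

Definition irreducible p : Prop := forall x y, exists n, 0 < nstep p n x y.

(* The gcd of the return times to x is 1. *)
Definition aperiodic p : Prop :=
  forall x (e : nat),
    (forall n, (0 < n)%N -> 0 < nstep p n x x -> (e %| n)%N) -> e = 1%N.

Definition ergodic p : Prop := irreducible p /\ aperiodic p.

Definition invariant_pmf p rho : Prop :=
  [/\ forall x, 0 <= rho x, \sum_x rho x = 1
    & forall y, \sum_x rho x * p x y = rho y].

End FiniteKernel.

(* Times and sequence positions start at 1: the value of a process at time 0
   and the 0-th term of an index sequence i : nat -> nat are never used. *)
Section Process.
Context {R : realType} {d : measure_display} {T : measurableType d}.
Context (P : probability T R).

Definition history (S : {fset R}) (Z : nat -> T -> R) (s : nat -> S) (n : nat)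
    : set T :=
  [set w | forall m, (1 <= m <= n)%N -> Z m w = val (s m)].

(* The last clause is P(Z_(n+1) = s_(n+1) | Z_1 = s_1, ..., Z_n = s_n) =
   p(s_n, s_(n+1)), multiplied out so as to cover histories of probability 0. *)
Definition markov_chain (S : {fset R}) (p : S -> S -> R)
    (Z : nat -> {RV P >-> R}) : Prop :=
  [/\ stochastic p,
      forall n w, (1 <= n)%N -> Z n w \in S
    & forall n (s : nat -> S), (1 <= n)%N ->
        P (history Z s n.+1) =
        (P (history Z s n) * (p (s n) (s n.+1))%:E)%E].

Definition has_law (S : {fset R}) (X : T -> R) (rho : S -> R) : Prop :=
  forall x : S, P [set w | X w = val x] = (rho x)%:E.

Definition stationary_chain (S : {fset R}) (p : S -> S -> R) (rho : S -> R)
    (Z : nat -> {RV P >-> R}) : Prop :=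
  [/\ markov_chain p Z, invariant_pmf p rho & has_law (Z 1%N) rho].

Definition prodZ (Z : nat -> T -> R) (k : nat) (i : nat -> nat) (w : T) : R :=
  \prod_(1 <= a < k.+1) Z (i a) w.

End Process.

Definition times (k : nat) (i : nat -> nat) : Prop :=
  forall a, (1 <= a <= k)%N -> (1 <= i a)%N.

Definition ordered_times (k : nat) (i : nat -> nat) : Prop :=
  times k i /\ forall a, (1 <= a < k)%N -> (i a <= i a.+1)%N.

Definition is_min (A : set nat) (m : nat) : Prop :=
  A m /\ forall n, A n -> (m <= n)%N.

Definition distances (k : nat) (i j : nat -> nat) : set nat :=
  [set `|(i n)%:Z - (j m)%:Z|%N | n in [set n | (1 <= n <= k)%N]
                                & m in [set m | (1 <= m <= k)%N]].

Definition gaps (k : nat) (i : nat -> nat) : set nat :=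
  [set (i a.+1 - i a)%N | a in [set a | (1 <= a < k)%N]].

(* Main.v *)
Require Import Defs.
From mathcomp Require Import all_boot all_order all_algebra finmap.
From mathcomp Require Import all_classical all_reals all_analysis measurable_realfun.
From mathcomp Require Import zify ring lra.

Set Implicit Arguments.
Unset Strict Implicit.
Unset Printing Implicit Defensive.

Import Order.TTheory GRing.Theory Num.Theory.

Local Open Scope classical_set_scope.
Local Open Scope ring_scope.

(** Everything follows from one mixing estimate. Write E(s) for the mean of the
    product of the Z_t over a list s of times. If every time of t comes at
    least d after every time of s, then (lemma [moment_mixing])

      |E(s ++ t) - E(s) E(t)| <= C B^(|s| + |t|) b^d,  with b < 1.

    Its source is the uniform geometric convergence of p^n v to the mean of v
    ([geometric_ergodicity]): a finite irreducible aperiodic kernel has a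
    power with positive entries, and a kernel with p >= e rho contracts the
    functions of mean zero by 1 - e. To transfer this to the process, joint
    moments are written as rho z^(c_1) A z^(c_2) A ... with A the averaging
    operator of p and c_l the multiplicity of the time l
    ([expectation_monomial]); a gap of length d between s and t appears in
    this formula as the factor A^d.

    The three bounds are then combinatorial.
    - First bound: cutting i_1 <= ... <= i_k behind an odd position a leaves
      two lists of odd length, whose moments vanish, so |E| <= C b^(n_a). This
      holds for the largest of the odd gaps n_a, and the sum of these gaps is
      at most k times the largest. So a rate b' with b <= b'^(k+1) turns the
      bound into a power of b' whose exponent is the sum.
    - Second bound ([decorrelation]): the lists i and j split into alternating
      blocks at mutual distance at least d, and the mixing estimate removes
      one block at a time.
    - Third bound ([moment_squares]): the squares are peeled off from the last
      time on, each contributing E(Z_t^2) = 1. *)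

(** * Positive return times and roots *)

Section NumericalSemigroup.
Variable D : pred nat.
Hypothesis D0 : D 0%N.
Hypothesis DD : forall m n, D m -> D n -> D (m + n)%N.

Lemma semigroup_muln q a : D a -> D (q * a)%N.
Proof. by move=> Da; elim: q => [|q IH] //; rewrite mulSn; exact: DD. Qed.

(** Let e be the least positive difference of two elements of D. Any n in D is
    divisible by e, since otherwise n %% e would be a smaller difference; hence
    e = 1, and D contains consecutive elements a, a + 1. Their combinations
    (q - r) a + r (a + 1) reach every q a + r with r < a <= q. *)
Lemma semigroup_eventually :
  (forall e, (forall n, (0 < n)%N -> D n -> (e %| n)%N) -> e = 1%N) ->
  exists N, forall n, (N <= n)%N -> D n.
Proof.
move=> gcd1.
pose gap e := (0 < e)%N && `[< exists2 a, D a & D (a + e)%N >].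
have exgap : exists e, gap e.
  have /existsNP[n /not_implyP[n0 /not_implyP[Dn _]]] :
      ~ (forall n, (0 < n)%N -> D n -> (2 %| n)%N) by move/gcd1.
  by exists n; rewrite /gap n0; apply/asboolP; exists 0%N.
case: (ex_minnP exgap) => e /andP[e0 /asboolP[a Da Dae]] mine.
have e1 : e = 1%N.
  apply: gcd1 => n n0 Dn; apply: contraT; rewrite /dvdn -lt0n => r0.
  have /mine : gap (n %% e)%N.
    rewrite /gap r0; apply/asboolP; exists ((n %/ e) * (a + e))%N.
      exact: semigroup_muln.
    have -> : ((n %/ e) * (a + e) + n %% e = (n %/ e) * a + n)%N.
      by rewrite {4}(divn_eq n e) mulnDr addnA.
    by apply: DD => //; exact: semigroup_muln.
  by rewrite leqNgt ltn_mod e0.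
rewrite {}e1 {mine exgap e0} in Dae.
exists (a * a)%N => n len.
case: (posnP a) => [a0|a0].
  by rewrite -(muln1 n); apply: semigroup_muln; move: Dae; rewrite a0.
have lr : (n %% a <= n %/ a)%N.
  by apply: leq_trans (ltnW (ltn_pmod n a0)) _; rewrite leq_divRL.
have -> : n = ((n %/ a - n %% a) * a + (n %% a) * (a + 1))%N.
  by rewrite mulnDr muln1 addnA -mulnDl subnK // -divn_eq.
by apply: DD; exact: semigroup_muln.
Qed.
End NumericalSemigroup.

(** Bernoulli's inequality provides the explicit root 1 - (1 - g) / (n + 2). *)
Lemma exists_large_root (R : realFieldType) (g : R) (n : nat) :
  0 <= g < 1 -> exists2 b : R, 0 < b < 1 & g <= b ^+ n.+1.
Proof.
move=> /andP[g0 g1]; pose b : R := 1 - (1 - g) / n.+2%:R.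
have n0 : 0 < n.+2%:R :> R by rewrite ltr0n.
have le1 m : (m <= n.+2)%N -> (1 - g) / n.+2%:R * m%:R <= 1.
  move=> mn; rewrite mulrAC ler_pdivrMr // mul1r.
  apply: (@le_trans _ _ (1 * n.+2%:R)); last by rewrite mul1r.
  by apply: ler_pM => //; rewrite ?ler_nat //; lra.
have b0 : 0 < b.
  rewrite /b subr_gt0 ltr_pdivrMr // mul1r.
  by apply: (@le_lt_trans _ _ 1); [lra|rewrite ltr1n].
have b1 : b < 1 by rewrite /b ltrBlDr ltrDl divr_gt0 //; lra.
exists b; first by rewrite b0.
have bern m : 1 - (1 - g) / n.+2%:R * m%:R <= b ^+ m.
  elim: m => [|m IH]; first by rewrite mulr0 subr0 expr0.
  rewrite exprS; apply: le_trans (ler_wpM2l (ltW b0) IH).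
  rewrite /b -natr1; set t := _ / _.
  have : 0 <= t * t * m%:R by rewrite mulr_ge0 // -expr2 sqr_ge0.
  by lra.
apply: le_trans (bern n.+1).
rewrite lerBrDr -lerBrDl mulrAC ler_pdivrMr // ler_wpM2l ?ler_nat //; lra.
Qed.

(** * Geometric ergodicity of a finite chain *)

Section FiniteChain.
Context {R : realType} {S : finType}.
Variable p : S -> S -> R.
Implicit Types (v : S -> R) (K : R).

(** The conditional mean of v(Z_(m+n)) given Z_m = x. *)
Definition evolve n v : S -> R := fun x => \sum_y nstep p n x y * v y.

Lemma nstepD m n x y :
  nstep p (m + n) x y = \sum_z nstep p m x z * nstep p n z y.
Proof.
elim: m x => [|m IH] x /=.
  rewrite (bigD1 x) //= eqxx mul1r big1 ?addr0 // => z.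
  by rewrite eq_sym => /negPf ->; rewrite mul0r.
under eq_bigr do rewrite IH mulr_sumr.
rewrite exchange_big /=; apply: eq_bigr => z _.
by rewrite mulr_suml; apply: eq_bigr => u _; rewrite mulrA.
Qed.

Lemma evolve0 v : evolve 0 v = v.
Proof.
apply/funext => x; rewrite /evolve (bigD1 x) //= eqxx mul1r big1 ?addr0 // => z.
by rewrite eq_sym => /negPf ->; rewrite mul0r.
Qed.

Lemma evolveD m n v : evolve (m + n) v = evolve m (evolve n v).
Proof.
apply/funext => x; rewrite /evolve.
under eq_bigr do rewrite nstepD mulr_suml.
rewrite exchange_big /=; apply: eq_bigr => z _.
by rewrite mulr_sumr; apply: eq_bigr => u _; rewrite mulrA.
Qed.

Lemma evolve1 v x : evolve 1 v x = \sum_y p x y * v y.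
Proof.
rewrite /evolve; apply: eq_bigr => y _ /=; rewrite (bigD1 y) //= eqxx mulr1.
by rewrite big1 ?addr0 // => z /negPf ->; rewrite mulr0.
Qed.

Lemma evolveB n v w x :
  evolve n (fun y => v y - w y) x = evolve n v x - evolve n w x.
Proof. by rewrite /evolve -sumrB; apply: eq_bigr => y _; rewrite mulrBr. Qed.

Hypothesis p_stoch : stochastic p.

Lemma nstep_ge0 n x y : 0 <= nstep p n x y.
Proof.
elim: n x => [|n IH] x /=; first by rewrite ler0n.
by apply: sumr_ge0 => z _; rewrite mulr_ge0 // (proj1 p_stoch).
Qed.

Lemma evolve_cst n c : evolve n (fun=> c) = fun=> c.
Proof.
elim: n => [|n IH]; first exact: evolve0.
rewrite -addn1 evolveD (_ : evolve 1 _ = fun=> c) //.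
by apply/funext => x; rewrite evolve1 -mulr_suml (proj2 p_stoch) mul1r.
Qed.

Lemma evolve_bound n v K x :
  (forall y, `|v y| <= K) -> `|evolve n v x| <= K.
Proof.
move=> vK; have -> : K = evolve n (fun=> K) x by rewrite evolve_cst.
apply: le_trans (ler_norm_sum _ _ _) _; apply: ler_sum => y _.
by rewrite normrM ger0_norm ?nstep_ge0 // ler_wpM2l ?nstep_ge0.
Qed.

Variable rho : S -> R.
Hypothesis rho_inv : invariant_pmf p rho.

Lemma mean_evolve n v : \sum_x rho x * evolve n v x = \sum_x rho x * v x.
Proof.
have [_ _ inv] := rho_inv; elim: n v => [|n IH] v.
  by under eq_bigr do rewrite evolve0.
rewrite -addn1 evolveD IH; under eq_bigr do rewrite evolve1 mulr_sumr.
rewrite exchange_big /=; apply: eq_bigr => y _; rewrite -inv mulr_suml.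
by apply: eq_bigr => x _; rewrite mulrA.
Qed.

Lemma mean_bound v K : (forall y, `|v y| <= K) -> `|\sum_x rho x * v x| <= K.
Proof.
have [rho0 rho1 _] := rho_inv => vK.
rewrite -[leRHS]mul1r -rho1 mulr_suml.
apply: le_trans (ler_norm_sum _ _ _) _; apply: ler_sum => y _.
by rewrite normrM ger0_norm // ler_wpM2l.
Qed.

Hypothesis p_erg : ergodic p.

(** The return times to x form an additive semigroup of gcd 1, so x returns to
    itself at all large times; irreducibility then reaches y from there. *)
Lemma primitive : exists N, forall x y, 0 < nstep p N.+1 x y.
Proof.
have [irr aper] := p_erg.
have trans m n x y z : 0 < nstep p m x y -> 0 < nstep p n y z ->
    0 < nstep p (m + n) x z.
  move=> xy yz; rewrite nstepD (bigD1 y) //= ltr_pwDl ?mulr_gt0 //.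
  by apply: sumr_ge0 => u _; rewrite mulr_ge0 ?nstep_ge0.
have ev x y : exists N, forall n, (N <= n)%N -> 0 < nstep p n x y.
  have [m mxy] := irr x y.
  have [||e h|N hN] := @semigroup_eventually (fun n => 0 < nstep p n x x).
  - by rewrite /= eqxx ltr01.
  - by move=> a b; exact: trans.
  - exact: aper h.
  exists (N + m)%N => n len; rewrite -(@subnK m n); last by lia.
  by apply: trans mxy; apply: hN; lia.
have /choice[N1 hN1] : forall xy : S * S, exists N,
    forall n, (N <= n)%N -> 0 < nstep p n xy.1 xy.2 by move=> [x y]; exact: ev.
exists (\max_xy N1 xy)%N => x y; apply: (hN1 (x, y)); apply: leqW.
exact: leq_bigmax.
Qed.

(** Let e be the minimum of 1 and the entries of p^(N+1). As rho <= 1, the kernel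
    p^(N+1)(x, y) - e rho(y) is nonnegative of total mass 1 - e, and it acts
    like p^(N+1) on the functions of mean zero. *)
Lemma doeblin : exists N, exists2 g : R, 0 <= g < 1 &
  forall v K x, \sum_y rho y * v y = 0 -> (forall y, `|v y| <= K) ->
    `|evolve N.+1 v x| <= g * K.
Proof.
have [rho0 rho1 _] := rho_inv; have [N hN] := primitive; exists N.
have [e e0 he] : exists2 e : R, 0 < e <= 1 & forall x y, e <= nstep p N.+1 x y.
  pose e := \big[Order.min/1]_(xy : S * S) nstep p N.+1 xy.1 xy.2.
  exists e; last by move=> x y; exact: (@bigmin_le _ _ _ _ (x, y)
    (fun xy : S * S => nstep p N.+1 xy.1 xy.2)).
  rewrite bigmin_le_id andbT; apply: lt_bigmin; first exact: ltr01.
  by move=> [x y] _; exact: hN.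
have rho_le1 y : rho y <= 1.
  by rewrite -rho1 (bigD1 y) //= lerDl sumr_ge0.
exists (1 - e); first by lra.
move=> v K x v0 vK.
have -> : evolve N.+1 v x = \sum_y (nstep p N.+1 x y - e * rho y) * v y.
  rewrite /evolve; under [RHS]eq_bigr do rewrite mulrBl -mulrA.
  by rewrite sumrB -mulr_sumr v0 mulr0 subr0.
have -> : (1 - e) * K = \sum_y (nstep p N.+1 x y - e * rho y) * K.
  rewrite -mulr_suml sumrB -mulr_sumr rho1 mulr1; congr ((_ - _) * _).
  have := congr1 (@^~ x) (evolve_cst N.+1 1); rewrite /evolve => <-.
  by under eq_bigr do rewrite mulr1.
apply: le_trans (ler_norm_sum _ _ _) _; apply: ler_sum => y _.
have c0 : 0 <= nstep p N.+1 x y - e * rho y.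
  have := he x y; have := rho_le1 y; have := rho0 y.
  by rewrite subr_ge0 => h0 h1; apply: le_trans; rewrite ler_piMr //; lra.
by rewrite normrM ger0_norm // ler_wpM2l.
Qed.

(** The contraction applies once in every N + 1 steps, which costs a root of the
    factor g in the rate, and at most N steps are left over, which costs the
    power b^(N+1) in the constant. *)
Lemma geometric_ergodicity : exists C b : R,
  [/\ 0 < C, 0 < b < 1 & forall n v K x, (forall y, `|v y| <= K) ->
    `|evolve n v x - \sum_y rho y * v y| <= C * b ^+ n * K].
Proof.
have [_ rho1 _] := rho_inv.
have [N [g g01 contr]] := doeblin.
have [b b01 gb] := exists_large_root N g01.
have [b0 b1] : 0 < b /\ b < 1 by lra.
exists (2 / b ^+ N.+1), b; split => //.
  by rewrite divr_gt0 // exprn_gt0.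
move=> n v K x vK.
have K0 : 0 <= K by apply: le_trans (normr_ge0 _) (vK x).
set c := \sum_y _; pose w y := v y - c.
have -> : evolve n v x - c = evolve n w x by rewrite evolveB evolve_cst.
have w0 : \sum_y rho y * w y = 0.
  under eq_bigr do rewrite mulrBr.
  by rewrite sumrB -mulr_suml rho1 mul1r subrr.
have wK y : `|w y| <= 2 * K.
  apply: le_trans (ler_normB _ _) _; have := mean_bound vK; have := vK y.
  by rewrite -/c; lra.
have iter q y : `|evolve (q * N.+1) w y| <= g ^+ q * (2 * K).
  elim: q y => [|q IH] y; first by rewrite mul0n evolve0 mul1r.
  rewrite mulSn evolveD exprS -mulrA; apply: contr IH.
  by rewrite mean_evolve.
have -> : evolve n w x = evolve (n %% N.+1) (evolve (n %/ N.+1 * N.+1) w) x.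
  by rewrite -evolveD addnC -divn_eq.
apply: le_trans (evolve_bound _ _ (iter _)) _.
apply: le_trans (_ : b ^+ (n %/ N.+1 * N.+1) * (2 * K) <= _).
  by rewrite mulnC exprM ler_wpM2r ?mulr_ge0 // lerXn2r ?nnegrE; lra.
rewrite [leRHS](_ : _ = b ^+ n / b ^+ N.+1 * (2 * K)); last by ring.
rewrite ler_wpM2r ?mulr_ge0 // ler_pdivlMr ?exprn_gt0 // -exprD.
rewrite {2}(divn_eq n N.+1) ler_wiXn2l; try lra.
by rewrite leq_add2l ltnW // ltn_mod.
Qed.
End FiniteChain.

(** * Products over times as iterated operators *)

Section WeightedOperators.
Context {R : realType} {S : finType}.
Variables (p : S -> S -> R) (z : S -> R).
Implicit Types (c : nat -> nat) (v : S -> R).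

(** The operator z^(c l) A z^(c l.+1) A ... A applied to v, where A averages with
    p. Recording a list of times by its multiplicities c makes concatenation
    of lists an addition of multiplicities, so that no sorting is needed. *)
Fixpoint weighted c v l n : S -> R :=
  if n is m.+1 then fun x => z x ^+ c l * evolve p 1 (weighted c v l.+1 m) x
  else v.

Lemma weighted_nil c v l : weighted c v l 0 = v.
Proof. by []. Qed.

Lemma weightedS c v l n x : weighted c v l n.+1 x =
  z x ^+ c l * \sum_y p x y * weighted c v l.+1 n y.
Proof. by rewrite /= evolve1. Qed.

Lemma weightedD c v l m n :
  weighted c v l (m + n) = weighted c (weighted c v (l + m) n) l m.
Proof.
elim: m l => [|m IH] l /=; first by rewrite addn0.
by rewrite IH addSnnS.
Qed.

Lemma eq_weighted c c' v l n :
  (forall a, (l <= a < l + n)%N -> c a = c' a) ->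
  weighted c v l n = weighted c' v l n.
Proof.
elim: n l => [|n IH] l //= cc'; rewrite (IH l.+1) ?cc' //; first by lia.
by move=> a la; apply: cc'; lia.
Qed.

Lemma weighted0 c v l n :
  (forall a, (l <= a < l + n)%N -> c a = 0%N) ->
  weighted c v l n = evolve p n v.
Proof.
elim: n l => [|n IH] l c0 /=; first by rewrite evolve0.
rewrite IH => [|a la]; last by apply: c0; lia.
apply/funext => x; rewrite c0; last by lia.
by rewrite mul1r -evolveD add1n.
Qed.

Lemma weightedBM c v k l n x :
  weighted c (fun y => v y - k) l n x =
  weighted c v l n x - k * weighted c (fun=> 1) l n x.
Proof.
elim: n l x => [|n IH] l x /=; first by rewrite mulr1.
rewrite mulrCA -mulrBr; congr (_ * _).
by rewrite /evolve mulr_sumr -sumrB; apply: eq_bigr => y _; rewrite IH; ring.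
Qed.

Hypothesis p_stoch : stochastic p.

Lemma weighted_single c l x : weighted c (fun=> 1) l 1 x = z x ^+ c l.
Proof.
rewrite weightedS; under eq_bigr do rewrite mulr1.
by rewrite (proj2 p_stoch) mulr1.
Qed.

Lemma weighted_bound B K c v l n x :
  (forall y, `|z y| <= B) -> (forall y, `|v y| <= K) ->
  `|weighted c v l n x| <= (\prod_(l <= a < l + n) B ^+ c a) * K.
Proof.
move=> zB vK; have B0 : 0 <= B by apply: le_trans (zB x).
elim: n l x => [|n IH] l x /=; first by rewrite addn0 big_geq // mul1r.
rewrite big_ltn; last by lia.
rewrite normrM normrX -mulrA ler_pM ?exprn_ge0 //; first by rewrite lerXn2r ?nnegrE.
by apply: evolve_bound => // y; rewrite -addSnnS; exact: IH.
Qed.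

End WeightedOperators.
Arguments weighted : simpl never.


(** * Lists of times *)

Lemma prod_count (R : comNzRingType) (z : nat -> R) (s : seq nat) (m n : nat) :
  {in s, forall t, m <= t < n}%N ->
  \prod_(m <= l < n) z l ^+ count_mem l s = \prod_(t <- s) z t.
Proof.
elim: s => [|t s IH] sN.
  by rewrite big_nil big1_seq // => l _; rewrite expr0.
rewrite big_cons -IH => [|u us]; last by apply: sN; rewrite inE us orbT.
under eq_bigr do rewrite /= exprD.
rewrite big_split /=; congr (_ * _).
have tN : (m <= t < n)%N by apply: sN; rewrite mem_head.
rewrite (bigD1_seq t) ?iota_uniq ?mem_index_iota //=.
by rewrite eqxx expr1 big1 ?mulr1 // => l /negPf; rewrite eq_sym => ->.
Qed.

Lemma exists_max (s : seq nat) : s != [::] ->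
  exists2 m, m \in s & {in s, forall x, x <= m}%N.
Proof.
elim: s => // a [|b s] IH _.
  by exists a; rewrite ?mem_head // => x; rewrite inE => /eqP ->.
have [//|m ms mmax] := IH.
exists (maxn a m); first by rewrite inE; case: leqP => _; rewrite ?ms ?eqxx ?orbT.
by move=> x; rewrite inE => /orP[/eqP ->|/mmax]; lia.
Qed.

Lemma seq_bounded (s : seq nat) : {in s, forall t, 1 <= t}%N ->
  {in s, forall t, 1 <= t < (\max_(u <- s) u).+1}%N.
Proof. by move=> s1 t ts; rewrite s1 //= ltnS leq_bigmax_seq. Qed.

(** * Joint moments and mixing of the process *)

Section ChainMoments.
Variables (R : realType) (disp : measure_display) (T : measurableType disp).
Variables (P : probability T R) (S : {fset R}) (p : S -> S -> R) (rho : S -> R).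
Variable Z : nat -> {RV P >-> R}.
Hypothesis HZ : stationary_chain p rho Z.

Local Notation weighted := (weighted p (val : S -> R)).

Lemma measurable_history (s : nat -> S) n : measurable (history Z s n).
Proof.
have -> : history Z s n =
    \bigcap_(m in [set m | (1 <= m <= n)%N]) (Z m @^-1` [set val (s m)]).
  by apply/seteqP; split.
apply: fin_bigcap_measurable.
  by apply: (@sub_finite_set _ _ `I_n.+1) => // m /= /andP[].
by move=> m _; rewrite -[X in measurable X]setTI; exact: measurable_funP.
Qed.

Lemma measurable_monomial (c : nat -> nat) n :
  measurable_fun [set: T] (fun w => \prod_(1 <= l < n) Z l w ^+ c l).
Proof. by apply: measurable_prod => l _; exact: measurable_funX. Qed.

Definition extend (s : nat -> S) j x : nat -> S :=
  fun m => if m == j.+1 then x else s m.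

Lemma history_extend (s : nat -> S) j :
  history Z s j = \big[setU/set0]_(x : S) history Z (extend s j x) j.+1.
Proof.
have [[_ inS _] _ _] := HZ.
rewrite -bigcup_seq; apply/seteqP; split => w /=.
  move=> hw; have wS := inS j.+1 w isT.
  exists [` wS]%fset; first by rewrite /= mem_index_enum.
  move=> m mj; rewrite /extend; case: eqP => [->//|mj']; apply: hw; lia.
move=> [x _ hw] m mj; rewrite hw /extend; last by lia.
by case: eqP => //; lia.
Qed.

Lemma integral_history_split (s : nat -> S) j (f : T -> R) :
  measurable_fun [set: T] f ->
  (\int[P]_(w in history Z s j) (f w)%:E =
   \sum_(x : S) \int[P]_(w in history Z (extend s j x) j.+1) (f w)%:E)%E.
Proof.
move=> mf; rewrite history_extend integral_bigsetU_EFin ?index_enum_uniq //.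
- by move=> x; exact: measurable_history.
- apply/trivIsetP => x y _ _ xy; apply/seteqP; split => // w /= [wx wy].
  case/negP: xy; apply/eqP/val_inj.
  have := wx j.+1; have := wy j.+1.
  by rewrite /extend eqxx ltnS leqnn => <- // <-.
- by apply/measurable_EFinP; exact: measurable_funTS.
Qed.

(** Conditioning on the first j values by downward induction on j: once all
    relevant values are fixed the integrand is constant, and releasing the
    value at time j + 1 averages over it with weights p. *)
Lemma integral_history (c : nat -> nat) (s : nat -> S) n j : (1 <= j)%N ->
  (\int[P]_(w in history Z s j)
      (\prod_(1 <= l < (j + n).+1) Z l w ^+ c l)%:E =
   (\prod_(1 <= l < j) val (s l) ^+ c l *
      weighted c (fun=> 1%R) j n.+1 (s j))%:E * P (history Z s j))%E.
Proof.
have [[st _ step] _ _] := HZ.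
elim: n j s => [|n IH] j s j1.
  rewrite addn0 weighted_single // -big_nat_recr //=.
  rewrite -integral_cst; last exact: measurable_history.
  apply: eq_integral => w; rewrite inE => hw; congr EFin.
  apply: eq_big_nat => l lj; rewrite hw //; lia.
rewrite integral_history_split; last exact: measurable_monomial.
rewrite -addSnnS /=; under eq_bigr => x _.
  rewrite IH // step // /extend eqxx (_ : j == j.+1 = false); last by lia.
  rewrite (_ : P _ = P (history Z s j)); last first.
    congr (P _); apply/seteqP; split => w hw m mj; have := hw m mj;
    by rewrite (_ : m == j.+1 = false) //; lia.
  rewrite (_ : \prod_(_ <= _ < _) _ =
      \prod_(1 <= l < j) val (s l) ^+ c l * val (s j) ^+ c j); last first.
    rewrite big_nat_recr //= (_ : j == j.+1 = false); last by lia.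
    congr (_ * _); apply: eq_big_nat => l lj.
    by rewrite (_ : l == j.+1 = false) //; lia.
  rewrite muleCA -EFinM.
  over.
have /fineK <- : P (history Z s j) \is a fin_num.
  by apply: fin_num_measure; exact: measurable_history.
under eq_bigr do rewrite -EFinM.
rewrite sumEFin -EFinM; congr EFin.
rewrite -mulr_sumr mulrC; congr (_ * _).
rewrite [in RHS]weightedS mulrA mulr_sumr.
by apply: eq_bigr => x _; ring.
Qed.

Lemma expectation_monomial (s : seq nat) N : {in s, forall t, 1 <= t < N.+1}%N ->
  ('E_P[fun w => (\prod_(t <- s) Z t w)%R] =
   (\sum_x rho x * weighted (fun l => count_mem l s) (fun=> 1) 1 N x)%:E)%E.
Proof.
have [[st _ _] [rho0 rho1 _] law] := HZ.
case: N => [|N] sN.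
  case: s sN => [|t s] sN; last by have := sN t (mem_head _ _); lia.
  rewrite (_ : (fun w => _) = cst 1); last by apply/funext => w; rewrite big_nil.
  by rewrite expectation_cst; under eq_bigr do rewrite weighted_nil mulr1; rewrite rho1.
have [x0 _] : exists x0 : S, True.
  case: (pickP (xpredT : pred S)) => [x0 _|S0]; first by exists x0.
  by move: rho1; rewrite big_pred0 // => /esym/eqP; rewrite oner_eq0.
rewrite unlock.
have -> : setT = history Z (fun=> x0) 0.
  by apply/seteqP; split => // w _ m; lia.
under eq_integral => w _ do rewrite -(prod_count (fun t => Z t w) sN).
rewrite integral_history_split; last exact: measurable_monomial.
rewrite -sumEFin; apply: eq_bigr => x _.
rewrite integral_history // big_geq // mul1r muleC [RHS]EFinM; congr (_ * _)%E.
rewrite -law; congr (P _); apply/seteqP; split => w.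
  by move/(_ 1%N isT).
by move=> /= wx m m1; have -> : m = 1%N by lia.
Qed.

Definition moment (s : seq nat) : R :=
  fine 'E_P[fun w => \prod_(t <- s) Z t w].

Lemma moment_weighted (s : seq nat) N : {in s, forall t, 1 <= t < N.+1}%N ->
  moment s =
    \sum_x rho x * weighted (fun l => count_mem l s) (fun=> 1) 1 N x.
Proof. by move=> sN; rewrite /moment (expectation_monomial sN). Qed.

Lemma moment_nil : moment [::] = 1.
Proof.
rewrite /moment (_ : (fun w => _) = cst 1) ?expectation_cst //.
by apply/funext => w; rewrite big_nil.
Qed.

Lemma perm_moment s t : perm_eq s t -> moment s = moment t.
Proof.
move=> st; congr (fine 'E_P[_]); apply/funext => w; exact: perm_big.
Qed.

Lemma expectation_moment (s : seq nat) : {in s, forall t, 1 <= t}%N ->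
  ('E_P[fun w => (\prod_(t <- s) Z t w)%R] = (moment s)%:E)%E.
Proof.
by move=> /seq_bounded sN; rewrite (expectation_monomial sN) (moment_weighted sN).
Qed.

Lemma moment_bound (B : R) (s : seq nat) : (forall x : S, `|val x| <= B) ->
  {in s, forall t, 1 <= t}%N -> `|moment s| <= B ^+ size s.
Proof.
have [[st _ _] inv _] := HZ.
move=> SB /seq_bounded sN; rewrite (moment_weighted sN).
apply: (mean_bound inv) => y.
apply: le_trans (weighted_bound st _ _ _ _ SB (K := 1) _) _.
  by move=> x; rewrite normr1.
rewrite add1n (prod_count (fun=> B) sN) mulr1.
by rewrite big_const_seq count_predT iter_mulr_1.
Qed.

(** If m is the last time of s, the moment of s ++ t is the weighted operator of
    s up to time m applied to p^(d-1) v, where v encodes t. Replacing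
    p^(d-1) v by its limit, the mean of v, which is E(t), produces the product
    E(s) E(t). The exponent d - 1 is compensated by a factor 1 / b in the
    constant; for d = 0 the trivial bound is enough, whence the summand 2. *)
Lemma moment_mixing : ergodic p -> exists C B b : R,
  [/\ 1 <= C /\ 1 <= B, 0 < b < 1,
    forall s, {in s, forall t, 1 <= t}%N -> `|moment s| <= B ^+ size s
  & forall s t d, {in s, forall x, 1 <= x}%N -> {in t, forall x, 1 <= x}%N ->
    {in s & t, forall x y, x + d <= y}%N ->
    `|moment (s ++ t) - moment s * moment t|
      <= C * B ^+ (size s + size t) * b ^+ d].
Proof.
have [[st _ _] inv _] := HZ.
move=> /(geometric_ergodicity st inv)[C0 [b [C00 b01 mix]]].
pose B : R := 1 + \sum_(x : S) `|val x|.
have SB (x : S) : `|val x| <= B.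
  by rewrite /B (bigD1 x) //= addrCA lerDl addr_ge0 // sumr_ge0.
have B1 : 1 <= B by rewrite lerDl sumr_ge0.
have bd s := @moment_bound B s SB.
have Cb0 : 0 < C0 / b by rewrite divr_gt0 //; lra.
exists (2 + C0 / b), B, b; split => //; first by split => //; lra.
move=> s t d s1 t1 sdt.
have e0 : 0 < B ^+ (size s + size t) by rewrite exprn_gt0 //; lra.
have bd0 : 0 < b ^+ d by rewrite exprn_gt0 //; lra.
have [->|sn0] := eqVneq s [::].
  rewrite cat0s moment_nil mul1r subrr normr0.
  by rewrite !mulr_ge0 ?exprn_ge0 //; lra.
case: d sdt bd0 => [|n] sdt bd0.
  rewrite mulr1; apply: le_trans (ler_normB _ _) _.
  have : `|moment (s ++ t)| <= B ^+ (size s + size t).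
    rewrite -size_cat; apply: bd => x; rewrite mem_cat => /orP[]; [exact: s1|exact: t1].
  have : `|moment s * moment t| <= B ^+ (size s + size t).
    by rewrite normrM exprD ler_pM // bd.
  nra.
have [m ms mmax] := exists_max sn0.
pose r := (\max_(u <- t) u)%N.
pose cs l := count_mem l s; pose ct l := count_mem l t.
have cs0 a : (m < a)%N -> cs a = 0%N.
  by move=> ma; apply/count_memPn/negP => /mmax; lia.
have ct0 a : (a <= m + n)%N -> ct a = 0%N.
  by move=> ma; apply/count_memPn/negP => /(sdt _ _ ms); lia.
pose v := weighted ct (fun=> 1) (1 + m + n) r.
have tr u : u \in t -> (1 + m + n <= u < 1 + m + n + r)%N.
  move=> ut; have := sdt _ _ ms ut; have : (u <= r)%N by exact: leq_bigmax_seq.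
  lia.
have Est : moment (s ++ t) =
    \sum_x rho x * weighted cs (evolve p n v) 1 m x.
  rewrite (@moment_weighted _ (m + (n + r))); last first.
    move=> u; rewrite mem_cat => /orP[us|/tr]; last by lia.
    by have := s1 _ us; have := mmax _ us; lia.
  apply: eq_bigr => x _; rewrite !weightedD; congr (_ * _).
  rewrite (@eq_weighted _ _ _ _ _ cs); last first.
    by move=> a am; rewrite count_cat -/(ct a) ct0 ?addn0 //; lia.
  congr (weighted cs _ 1 m x); rewrite weighted0; last first.
    by move=> a am; rewrite count_cat -/(ct a) -/(cs a) ct0 ?cs0 //; lia.
  congr evolve; apply: eq_weighted => a am.
  by rewrite count_cat -/(cs a) cs0 //; lia.
have Es : moment s = \sum_x rho x * weighted cs (fun=> 1) 1 m x.
  by apply: moment_weighted => u us; rewrite s1 //= ltnS mmax.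
have Et : moment t = \sum_x rho x * v x.
  rewrite (@moment_weighted _ (m + n + r)); last by move=> u /tr; lia.
  rewrite weightedD -(mean_evolve inv (m + n) v); apply: eq_bigr => x _.
  by rewrite weighted0 ?addnA // => a am; apply: ct0; lia.
have vK y : `|v y| <= B ^+ size t.
  apply: le_trans (weighted_bound st _ _ _ _ SB (K := 1) _) _.
    by move=> x; rewrite normr1.
  rewrite (prod_count (fun=> B) tr) mulr1.
  by rewrite big_const_seq count_predT iter_mulr_1.
have -> : moment (s ++ t) - moment s * moment t =
    \sum_x rho x * weighted cs (fun y => evolve p n v y - moment t) 1 m x.
  rewrite Est Es mulr_suml -sumrB; apply: eq_bigr => x _.
  by rewrite weightedBM mulrBr; ring.
apply: (mean_bound inv) => y.
apply: le_trans (weighted_bound st _ _ _ _ SB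
  (K := C0 * b ^+ n * B ^+ size t) _) _.
  by move=> x; rewrite Et; exact: mix.
rewrite (prod_count (fun=> B)); last first.
  by move=> u us; rewrite s1 //= add1n ltnS mmax.
rewrite big_const_seq count_predT iter_mulr_1.
have -> : (2 + C0 / b) * B ^+ (size s + size t) * b ^+ n.+1 =
    B ^+ size s * (C0 * b ^+ n * B ^+ size t) +
    2 * B ^+ (size s + size t) * b ^+ n.+1.
  by rewrite exprD exprS; field; lra.
by rewrite lerDl !mulr_ge0 // ltW.
Qed.

End ChainMoments.

(** * Consequences of mixing for lists of times *)

Definition time_seq (i : nat -> nat) k := [seq i a | a <- index_iota 1 k.+1].

Lemma size_time_seq i k : size (time_seq i k) = k.
Proof. by rewrite size_map size_iota subn1. Qed.

Lemma time_seqP i k x :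
  x \in time_seq i k -> exists2 a, (1 <= a <= k)%N & x = i a.
Proof. by move=> /mapP[a]; rewrite mem_index_iota => ak ->; exists a. Qed.

Lemma time_seqS i k : time_seq i k.+1 = rcons (time_seq i k) (i k.+1).
Proof. by rewrite /time_seq /index_iota !subn1 /= -map_rcons -cats1 -(iotaD 1 k 1) addn1. Qed.

Lemma ordered_mono k i : ordered_times k i ->
  forall a a', (1 <= a)%N -> (a <= a' <= k)%N -> (i a <= i a')%N.
Proof.
move=> [_ io] a a' a1; elim: a' => [|a' IH] /andP[aa' a'k]; first by lia.
move: aa'; rewrite leq_eqVlt => /orP[/eqP -> //|aa'].
by apply: leq_trans (io a' _); [apply: IH|]; lia.
Qed.

(** The moments enter only through the properties assumed here, so that e may be
    any function on lists of times. *)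
Section Decorrelation.
Variables (R : realFieldType) (e : seq nat -> R) (C B b : R).
Local Notation pos s := {in s, forall t, 1 <= t}%N.
Hypothesis e_mix : forall s t d, pos s -> pos t ->
  {in s & t, forall x y, x + d <= y}%N ->
  `|e (s ++ t) - e s * e t| <= C * B ^+ (size s + size t) * b ^+ d.

Lemma moment_cut i k a : ordered_times k i -> (1 <= a < k)%N ->
  e (time_seq i a) = 0 ->
  `|e (time_seq i k)| <= C * B ^+ k * b ^+ (i a.+1 - i a).
Proof.
move=> ik ak ea; have [i1 io] := ik.
pose t := [seq i l | l <- index_iota a.+1 k.+1].
have st : time_seq i k = time_seq i a ++ t.
  by rewrite /time_seq /t -map_cat /index_iota !subn1 /= subSS -[in X in _ ++ X]add1n
    -iotaD subnKC //; lia.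
have sz : (size (time_seq i a) + size t)%N = k.
  by rewrite -size_cat -st size_time_seq.
rewrite st -[e _]subr0 -(mul0r (e t)) -ea -[in B ^+ _]sz.
apply: e_mix.
- by move=> x /time_seqP[l la ->]; apply: i1; lia.
- by move=> x /mapP[l]; rewrite mem_index_iota => la ->; apply: i1; lia.
move=> x y /time_seqP[l la ->] /mapP[m]; rewrite mem_index_iota => ma ->.
have : (i l <= i a)%N by apply: (ordered_mono ik); lia.
have : (i a.+1 <= i m)%N by apply: (ordered_mono ik); lia.
have : (i a <= i a.+1)%N by apply: io; lia.
lia.
Qed.

Hypotheses (C1 : 1 <= C) (B1 : 1 <= B) (b01 : 0 < b < 1).
Hypothesis e_nil : e [::] = 1.
Hypothesis e_perm : forall s t, perm_eq s t -> e s = e t.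

Let B_gt0 : 0 < B. Proof. exact: lt_le_trans B1. Qed.
Let C_ge0 : 0 <= C. Proof. exact: le_trans C1. Qed.
Let b_gt0 : 0 < b. Proof. by case/andP: b01. Qed.

(** Writing the product of squares as the moment of the list repeated twice, the
    two copies of the last time come at least d after all the others. *)
Lemma moment_squares i k d : ordered_times k i ->
  (forall t, (1 <= t)%N -> e [:: t; t] = 1) ->
  (forall a, (1 <= a < k)%N -> (i a + d <= i a.+1)%N) ->
  `|e (time_seq i k ++ time_seq i k) - 1| <= C * k%:R * B ^+ (k + k) * b ^+ d.
Proof.
move=> ik e2; elim: k ik => [|k IH] ik gap.
  by rewrite e_nil subrr normr0 mulr0 !mul0r.
have ik' : ordered_times k i.
  by case: ik => i1 io; split=> a ak; [apply: i1|apply: io]; lia.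
have {}IH := IH ik' (fun a ak => gap a ltac:(lia)).
set s := time_seq i k; set t := i k.+1.
have t1 : (1 <= t)%N by case: ik => i1 _; apply: i1; lia.
have s1 : pos s.
  by move=> x /time_seqP[a ak ->]; case: ik => i1 _; apply: i1; lia.
have E1 : `|e ((s ++ s) ++ [:: t; t]) - e (s ++ s) * e [:: t; t]| <=
    C * B ^+ (size (s ++ s) + 2) * b ^+ d.
  apply: e_mix.
  - by move=> x; rewrite mem_cat orbb => /s1.
  - by move=> x; rewrite !inE orbb => /eqP ->.
  move=> x y; rewrite mem_cat orbb => /time_seqP[a ak ->].
  rewrite !inE orbb => /eqP ->.
  apply: leq_trans (gap k _); last by lia.
  by rewrite leq_add2r; apply: (ordered_mono ik); lia.
have -> : e (time_seq i k.+1 ++ time_seq i k.+1) = e ((s ++ s) ++ [:: t; t]).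
  apply: e_perm; rewrite time_seqS -!cats1 -!catA perm_cat2l.
  by rewrite (perm_catCA [:: t]) perm_cat2l.
move: E1; rewrite e2 // mulr1 size_cat size_time_seq => E1.
rewrite (_ : e _ - 1 = (e ((s ++ s) ++ [:: t; t]) - e (s ++ s)) +
  (e (s ++ s) - 1)); last by ring.
apply: le_trans (ler_normD _ _) _; apply: le_trans (lerD E1 IH) _.
have -> : (k.+1 + k.+1 = k + k + 2)%N by lia.
have Bk : B ^+ (k + k) <= B ^+ (k + k + 2) by rewrite ler_weXn2l //; lia.
rewrite -natr1 -subr_ge0 [leRHS](_ : _ =
  C * k%:R * (B ^+ (k + k + 2) - B ^+ (k + k)) * b ^+ d); last by ring.
by rewrite !mulr_ge0 ?subr_ge0 ?exprn_ge0 // ltW.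
Qed.

Hypothesis e_bound : forall s, pos s -> `|e s| <= B ^+ size s.

(** Induction on the total length. If the last time belongs to s, let sh be the
    times of s after all of t, and sl the other ones. Mixing splits off sh from
    sl ++ t and, in the opposite direction, from sl; in between, the induction
    hypothesis separates sl from t. The two applications of mixing make the
    constant grow by 2 C at each step. *)
Lemma decorrelation s t d : pos s -> pos t ->
  {in s & t, forall x y, (x + d <= y) || (y + d <= x)}%N ->
  `|e (s ++ t) - e s * e t| <=
    2 * C * (size s + size t)%:R * B ^+ (size s + size t) * b ^+ d.
Proof.
move: {2}(_ + _)%N (leqnn (size s + size t)) => n.
elim: n s t => [|n IH] s t stn s1 t1 sep.
  move: stn sep s1 t1; rewrite leqn0 addn_eq0 !size_eq0 => /andP[/eqP -> /eqP ->].
  by rewrite e_nil mul1r subrr normr0 /= mulr0 !mul0r.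
have bd0 m : 0 < B ^+ m by exact: exprn_gt0.
have be0 : 0 < b ^+ d by exact: exprn_gt0.
have rhs0 : 0 <= 2 * C * (size s + size t)%:R * B ^+ (size s + size t) * b ^+ d.
  by rewrite !mulr_ge0 ?ler0n ?(ltW (bd0 _)) ?(ltW be0).
have [s0|sn0] := eqVneq s [::].
  by move: rhs0; rewrite s0 cat0s e_nil mul1r subrr normr0.
have [t0|tn0] := eqVneq t [::].
  by move: rhs0; rewrite t0 cats0 e_nil mulr1 subrr normr0.
have [x xs xmax] := exists_max sn0; have [y yt ymax] := exists_max tn0.
wlog yx : s t stn s1 t1 sep rhs0 sn0 tn0 x xs xmax y yt ymax / (y <= x)%N.
  move=> W; have [yx|xy] := leqP y x; first exact: (W s t) yx.
  have st : (size s + size t)%N = (size t + size s)%N by rewrite addnC.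
  have -> : e (s ++ t) = e (t ++ s) by apply: e_perm; rewrite perm_catC.
  rewrite [e s * _]mulrC st; rewrite st in stn rhs0.
  apply: (W t s stn t1 s1 _ rhs0 tn0 sn0 y yt ymax x xs xmax (ltnW xy)).
  by move=> u v ut vs; rewrite orbC; exact: sep.
(* Both sides of y are at distance at least d from it, so sl and sh are too;
   sh contains x, which makes the induction progress. *)
pose sl := [seq u <- s | (u < y)%N]; pose sh := [seq u <- s | ~~ (u < y)%N].
have pS : perm_eq s (sl ++ sh) by rewrite perm_sym perm_filterC.
have szs : size s = (size sl + size sh)%N by rewrite (perm_size pS) size_cat.
have sh0 : (0 < size sh)%N.
  by rewrite size_filter -has_count; apply/hasP; exists x; rewrite // -leqNgt.
have sl1 : pos sl by move=> u; rewrite mem_filter => /andP[_ /s1].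
have sh1 : pos sh by move=> u; rewrite mem_filter => /andP[_ /s1].
have sly u : u \in sl -> (u + d <= y)%N.
  by rewrite mem_filter => /andP[uy us]; move: uy (sep _ _ us yt); clear; lia.
have shy u : u \in sh -> (y + d <= u)%N.
  by rewrite mem_filter => /andP[uy us]; move: uy (sep _ _ us yt); clear; lia.
have E1 : `|e ((sl ++ t) ++ sh) - e (sl ++ t) * e sh| <=
    C * B ^+ (size sl + size t + size sh) * b ^+ d.
  rewrite -size_cat; apply: e_mix => //.
    by move=> u; rewrite mem_cat => /orP[/sl1|/t1].
  move=> u v; rewrite mem_cat => /orP[/sly|/ymax] + /shy; clear; lia.
have E2 : `|e (sl ++ t) - e sl * e t| <=
    2 * C * (size sl + size t)%:R * B ^+ (size sl + size t) * b ^+ d.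
  have szn : (size sl + size t <= n)%N.
    move: stn sh0; rewrite szs; clear; lia.
  apply: IH => //.
  by move=> u v; rewrite mem_filter => /andP[_ us] vt; exact: sep.
have E3 : `|e (sl ++ sh) - e sl * e sh| <=
    C * B ^+ (size sl + size sh) * b ^+ d.
  by apply: e_mix => // u v /sly + /shy; clear; lia.
have -> : e (s ++ t) = e ((sl ++ t) ++ sh).
  apply: e_perm; rewrite -catA perm_sym.
  rewrite (perm_trans (_ : perm_eq _ (sl ++ (sh ++ t)))) //.
    by rewrite perm_cat2l perm_catC.
  by rewrite catA perm_cat2r perm_sym.
rewrite (e_perm pS).
rewrite (_ : _ - _ = (e ((sl ++ t) ++ sh) - e (sl ++ t) * e sh) +
  e sh * (e (sl ++ t) - e sl * e t) -
  e t * (e (sl ++ sh) - e sl * e sh)); last by ring.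
apply: le_trans (ler_normB _ _) _; apply: le_trans (lerD (ler_normD _ _) (lexx _)) _.
rewrite !normrM szs !exprD.
move: (bd0 (size sl)) (bd0 (size sh)) (bd0 (size t)) E1 E2 E3.
rewrite !exprD !natrD; set Bl := B ^+ _; set Bh := B ^+ _; set Bt := B ^+ _.
move=> Bl0 Bh0 Bt0 E1 E2 E3.
have F2 := ler_pM (normr_ge0 _) (normr_ge0 _) (e_bound sh1) E2.
have F3 := ler_pM (normr_ge0 _) (normr_ge0 _) (e_bound t1) E3.
apply: le_trans (lerD (lerD E1 F2) F3) _.
rewrite -/Bh -/Bt -subr_ge0 [leRHS](_ : _ =
   2 * ((size sh)%:R - 1) * (C * Bl * Bh * Bt * b ^+ d)); last by ring.
by rewrite !mulr_ge0 ?subr_ge0 ?ler1n ?(ltW Bl0) ?(ltW Bh0) ?(ltW Bt0) ?(ltW be0).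
Qed.

End Decorrelation.

Theorem lemma3p1 (R : realType) (disp : measure_display)
    (T : measurableType disp) (P : probability T R)
    (S : {fset R}) (p : S -> S -> R) (rho : S -> R)
    (Z : nat -> {RV P >-> R})
    (HZ : stationary_chain p rho Z)
    (Hp : ergodic p)
    (HZ2 : forall i, (1 <= i)%N -> ('E_P[fun w => (Z i w ^+ 2)%R] = 1)%E)
    (Hodd : forall k (i : nat -> nat), odd k -> times k i ->
        ('E_P[prodZ Z k i] = 0)%E) :
  forall k, ~~ odd k -> exists C beta : R,
    [/\ 0 < C, 0 <= beta < 1
      & forall i : nat -> nat, ordered_times k i ->
        [/\ (`|'E_P[prodZ Z k i]|
               <= (C * beta ^+ (\sum_(1 <= a < k | odd a) (i a.+1 - i a))%N)%:E)%E,
            forall (j : nat -> nat) (d : nat), ordered_times k j ->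
              is_min (distances k i j) d ->
              (`|'E_P[fun w => (prodZ Z k i w * prodZ Z k j w)%R]
                   - 'E_P[prodZ Z k i] * 'E_P[prodZ Z k j]|
                 <= (C * beta ^+ d)%:E)%E
          & forall d' : nat, is_min (gaps k i) d' ->
              (`|'E_P[fun w => (\prod_(1 <= a < k.+1) Z (i a) w ^+ 2)%R] - 1|
                 <= (C * beta ^+ d')%:E)%E]].
Proof.
have [[stoch Zin _] _ _] := HZ.
have [C0 [B [b [[C1 B1] b01 bd mix]]]] := moment_mixing HZ Hp.
have B0 : 0 < B by exact: lt_le_trans B1.
have [b0 b1] := andP b01.
move=> k kev.
have prodE k' (i : nat -> nat) :
    prodZ Z k' i = fun w => \prod_(t <- time_seq i k') Z t w.
  by apply/funext => w; rewrite /prodZ big_map.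
have [|b' /andP[b'0 b'1] bb'] := @exists_large_root R b k; first by rewrite ltW.
have bX n m : (m <= n * k.+1)%N -> b ^+ n <= b' ^+ m.
  move=> mn; apply: (@le_trans _ _ (b' ^+ (n * k.+1))).
    by rewrite mulnC exprM lerXn2r ?nnegrE ?exprn_ge0 // ltW.
  by apply: ler_wiXn2l => //; exact: ltW.
have bX1 n : b ^+ n <= b' ^+ n by apply: bX; rewrite leq_pmulr.
have Cge0 : 0 <= C0 by exact: le_trans C1.
have BX1 n : 1 <= B ^+ n by exact: exprn_ege1.
(* 2 (k + k) comes from the second bound, 1 from the first one. *)
pose C := C0 * (2 * (k + k)%:R + 1) * B ^+ (k + k).
have k0 : 0 <= (k + k)%:R :> R by exact: ler0n.
have Cle (c : R) n : c <= 2 * (k + k)%:R + 1 -> (n <= k + k)%N ->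
    C0 * c * B ^+ n <= C.
  move=> cle nle; apply: (@le_trans _ _ (C0 * (2 * (k + k)%:R + 1) * B ^+ n)).
    by rewrite ler_wpM2r ?exprn_ge0 ?(ltW B0) // ler_wpM2l.
  by rewrite ler_wpM2l ?ler_weXn2l // mulr_ge0 //; lra.
have C_gt0 : 0 < C.
  by rewrite !mulr_gt0 ?exprn_gt0 ?(lt_le_trans ltr01 C1) //; lra.
have C_ge0 := ltW C_gt0.
exists C, b'; split; rewrite ?(ltW b'0) // => i ik.
have tpos j : ordered_times k j -> {in time_seq j k, forall t, 1 <= t}%N.
  by move=> [j1 _] t /time_seqP[a ak ->]; exact: j1.
have Em := expectation_moment HZ.
split.
- rewrite prodE Em; last exact: tpos.
  rewrite abse_EFin lee_fin.
  (* The sum of the odd gaps is controlled by the largest of them. *)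
  pose N := (\max_(a < k | odd a) (i a.+1 - i a))%N.
  have sumN : (\sum_(1 <= a < k | odd a) (i a.+1 - i a) <= N * k.+1)%N.
    rewrite big_nat_cond; apply: (@leq_trans (\sum_(1 <= a < k) N)%N).
      rewrite [leqRHS]big_nat_cond [leqRHS]big_mkcond [leqLHS]big_mkcond.
      apply: leq_sum => a _; case: ifP => // /andP[] ak oa.
      rewrite andbT ak; have ak' : (a < k)%N by case/andP: ak.
      exact: (@leq_bigmax_cond _ _ _ (Ordinal ak')).
    by rewrite sum_nat_const_nat mulnC leq_mul // subn1 (leq_trans (leq_pred k)).
  case: (posnP k) => [k00|kpos].
    have -> : moment Z (time_seq i k) = 1 by rewrite k00 moment_nil.
    rewrite k00 big_geq // expr0 mulr1 normr1.
    by rewrite -[leLHS](mul1r 1) -{1}(mul1r 1) /C !ler_pM //; lra.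
  have k2 : (1 < k)%N by case: (k) kev kpos => [|[]].
  have [|a oa aN] := @eq_bigmax_cond _ [pred a : 'I_k | odd a]
      (fun a => i a.+1 - i a)%N.
    by apply/card_gt0P; exists (Ordinal k2).
  rewrite inE in oa.
  have a1 : (1 <= a < k)%N by rewrite ltn_ord andbT; case: (val a) oa.
  have e0 : moment Z (time_seq i a) = 0.
    have ia : times a i by move=> l la; apply: ik.1; move: la (ltn_ord a); clear; lia.
    by have := Hodd _ _ oa ia; rewrite prodE Em => [[]|t /time_seqP[l la ->]] //; exact: ia.
  apply: le_trans (moment_cut mix ik a1 e0) _.
  rewrite -aN -/N ler_pM ?mulr_ge0 ?exprn_ge0 ?(ltW B0) ?(ltW b0) ?bX //.
  by rewrite -{1}(mulr1 C0); apply: Cle; [lra|exact: leq_addr].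
- move=> j d jk [_ dmin].
  have -> : (fun w => prodZ Z k i w * prodZ Z k j w) =
      fun w => \prod_(t <- time_seq i k ++ time_seq j k) Z t w.
    by rewrite !prodE; apply/funext => w; rewrite big_cat.
  rewrite !prodE !Em; [|exact: tpos|exact: tpos|]; last first.
    by move=> t; rewrite mem_cat => /orP[]; exact: tpos.
  rewrite -EFinM -EFinB abse_EFin lee_fin.
  apply: le_trans (decorrelation mix C1 B1 b01 (moment_nil Z) (@perm_moment _ _ _ _ Z)
    bd (d := d) _ _ _) _; [exact: tpos|exact: tpos| |].
    move=> x y /time_seqP[n nk ->] /time_seqP[m mk ->].
    have : (d <= `|(i n)%:Z - (j m)%:Z|)%N.
      by apply: dmin; exists n => //; exists m.
    by clear; lia.
  rewrite !size_time_seq ler_pM ?mulr_ge0 ?exprn_ge0 ?(ltW B0) ?(ltW b0) //.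
  by rewrite [2 * C0]mulrC -[C0 * 2 * _]mulrA; apply: Cle => //; rewrite lerDl.
- move=> d [_ dmin].
  have -> : (fun w => \prod_(1 <= a < k.+1) Z (i a) w ^+ 2) =
      fun w => \prod_(t <- time_seq i k ++ time_seq i k) Z t w.
    by apply/funext => w; rewrite big_cat /= -expr2 -prodrXl big_map.
  rewrite Em => [|t]; last by rewrite mem_cat orbb; exact: tpos.
  rewrite -EFinB abse_EFin lee_fin.
  apply: le_trans (moment_squares mix C1 B1 b01 (moment_nil Z)
    (@perm_moment _ _ _ _ Z) (d := d) ik _ _) _.
  + move=> t t1; have := HZ2 _ t1.
    rewrite (_ : (fun w => _) = fun w => \prod_(u <- [:: t; t]) Z u w).
      by rewrite Em => [[]|u] //; rewrite !inE orbb => /eqP ->.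
    by apply/funext => w; rewrite !big_cons big_nil mulr1.
  + move=> a ak; have : (d <= i a.+1 - i a)%N by apply: dmin; exists a.
    have : (i a <= i a.+1)%N by apply: ik.2.
    by clear; lia.
  rewrite ler_pM ?mulr_ge0 ?exprn_ge0 ?(ltW B0) ?(ltW b0) //.
  by apply: Cle => //; rewrite natrD in k0 *; lra.
Qed.
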